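(* Let $\Delta: M_2(\mathbb{C})\to M_2(\mathbb{C})\otimes M_2(\mathbb{C})$ be a trace-preserving quasi quantum quadratic operator, and write, for $i=1,2,3$, $$\Delta(\sigma_i)=b_i(\mathbf 1\otimes \mathbf 1)+\sum_{j=1}^3 b^{(1)}_{ji}(\mathbf 1\otimes\sigma_j)+\sum_{j=1}^3 b^{(2)}_{ji}(\sigma_j\otimes \mathbf 1)+\sum_{m,l=1}^3 b_{ml,i}(\sigma_m\otimes\sigma_l)$$ with complex coefficients $b_i, b^{(1)}_{ji}, b^{(2)}_{ji}, b_{ml,i}$. Then $b_j=0$ for all $j\in\{1,2,3\}$, and $b^{(1)}_{ij}$, $b^{(2)}_{ij}$, $b_{ij,k}$ are real for all $i,j,k\in\{1,2,3\}$. Moreover, for every $x=w_0\mathbf 1+\mathbf w\sigma\in M_2(\mathbb{C})$ with $w_0\in\mathbb{C}$, $\mathbf w\in\mathbb{C}^3$, $$\Delta(x)=w_0\,\mathbf 1\otimes \mathbf 1+\mathbf 1\otimes \mathbf B^{(1)}\mathbf w\cdot\sigma+\mathbf B^{(2)}\mathbf w\cdot\sigma\otimes \mathbf 1+\sum_{m,l=1}^3\langle \mathbf b_{ml},\overline{\mathbf w}\rangle\,\sigma_m\otimes\sigma_l,$$ where $\mathbf b_{ml}=(b_{ml,1},b_{ml,2},b_{ml,3})$ and $\mathbf B^{(k)}=(b^{(k)}_{ij})_{i,j=1}^3$, $k=1,2$.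
   Context: $\mathbf 1$ is the $2\times 2$ identity matrix and $\sigma_1=\begin{pmatrix}0&1\\1&0\end{pmatrix}$, $\sigma_2=\begin{pmatrix}0&-i\\i&0\end{pmatrix}$, $\sigma_3=\begin{pmatrix}1&0\\0&-1\end{pmatrix}$ are the Pauli matrices; $\{\mathbf 1,\sigma_1,\sigma_2,\sigma_3\}$ is a basis of $M_2(\mathbb{C})$. For $\mathbf w=(w_1,w_2,w_3)\in\mathbb{C}^3$, $\mathbf w\sigma=\mathbf w\cdot\sigma=w_1\sigma_1+w_2\sigma_2+w_3\sigma_3$ and $\overline{\mathbf w}=(\overline{w_1},\overline{w_2},\overline{w_3})$. $\langle\cdot,\cdot\rangle$ is the standard scalar product on $\mathbb{C}^3$, linear in the first and conjugate-linear in the second argument. For a linear map $\Delta: M_2(\mathbb{C})\to M_2(\mathbb{C})\otimes M_2(\mathbb{C})$ and a linear functional $\varphi$ on $M_2(\mathbb{C})$, define $V_\Delta(\varphi)=(\varphi\otimes\varphi)\circ\Delta$. A functional $\varphi$ is positive if $\varphi(x)\ge 0$ whenever $x\geq 0$. $\Delta$ is a quasi quantum quadratic operator if it is linear, unital ($\Delta(\mathbf 1)=\mathbf 1\otimes \mathbf 1$), $*$-preserving ($\Delta(x^* )=\Delta(x)^*$ for all $x$), and $V_\Delta(\varphi)$ is a positive functional whenever $\varphi$ is a positive functional. Let $\tau(x)=\frac12\mathrm{Tr}(x)$ be the normalized trace; $\Delta$ is trace-preserving if $(\tau\otimes\tau)\circ\Delta=\tau$. *)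

(* Defs.v *)
From HB Require Import structures.
From mathcomp Require Import all_boot all_order all_algebra.
From mathcomp Require Import all_reals.
From mathcomp Require Export complex mxtens.

Set Implicit Arguments.
Unset Strict Implicit.
Unset Printing Implicit Defensive.

Import Order.TTheory GRing.Theory Num.Theory.
Local Open Scope ring_scope.
Local Open Scope sesquilinear_scope.
Local Open Scope complex_scope.

Notation "A *t B" := (tensmx A B)
  (at level 40, left associativity, format "A  *t  B") : ring_scope.

Section Defs.
Variable R : realType.
Local Notation C := R[i].

Definition mx2 (a b c d : C) : 'M[C]_2 :=
  \matrix_(i < 2, j < 2) nth 0 (nth [::] [:: [:: a; b]; [:: c; d]] i) j.

(* The indices 1, 2, 3 are the elements 0, 1, 2 of 'I_3. *)
Definition pauli (k : 'I_3) : 'M[C]_2 :=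
  nth 0 [:: mx2 0 1 1 0; mx2 0 (- 'i%C) 'i%C 0; mx2 1 0 0 (- 1)] k.

Definition dot_pauli (w : 'cV[C]_3) : 'M[C]_2 := \sum_(j < 3) w j 0 *: pauli j.

Definition innerC3 (u v : 'cV[C]_3) : C := \sum_(k < 3) u k 0 * Num.conj (v k 0).

(* No hermitianness clause is needed: over C, a matrix whose quadratic form
   takes real values is hermitian. *)
Definition psdmx (n : nat) (x : 'M[C]_n) : Prop :=
  forall v : 'cV[C]_n, 0 <= (v^t* *m x *m v) 0 0.

Definition positive_functional (n : nat) (phi : 'M[C]_n -> C) : Prop :=
  forall x : 'M[C]_n, psdmx x -> 0 <= phi x.

(* The linear functional on M_m(C) (x) M_n(C) extending
   x *t y |-> phi x * psi y, written on the basis E_ij *t E_kl;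
   see tens_funE. *)
Definition tens_fun (m n : nat) (phi : {scalar 'M[C]_m}) (psi : {scalar 'M[C]_n})
    (X : 'M[C]_(m * n)) : C :=
  \sum_(i < m) \sum_(j < m) \sum_(k < n) \sum_(l < n)
    X (mxtens_index (i, k)) (mxtens_index (j, l))
      * (phi (delta_mx i j) * psi (delta_mx k l)).

Fact tens_fun_is_linear m n phi psi : scalar (@tens_fun m n phi psi).
Proof.
move=> a X Y; rewrite /tens_fun /=.
do 4 (rewrite mulr_sumr -big_split; apply: eq_bigr => ? _ /=).
by rewrite !mxE mulrDl -mulrA.
Qed.

HB.instance Definition _ m n phi psi :=
  GRing.isLinear.Build C 'M[C]_(m * n) C *%R (@tens_fun m n phi psi)
    (@tens_fun_is_linear m n phi psi).

Lemma tens_funE m n (phi : {scalar 'M[C]_m}) (psi : {scalar 'M[C]_n}) x y :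
  tens_fun phi psi (x *t y) = phi x * psi y.
Proof.
rewrite [in phi x](matrix_sum_delta x) [in psi y](matrix_sum_delta y).
rewrite !linear_sum mulr_suml; apply: eq_bigr => i _.
rewrite linear_sum mulr_suml; apply: eq_bigr => j _.
rewrite mulr_sumr; apply: eq_bigr => k _.
rewrite linear_sum mulr_sumr; apply: eq_bigr => l _.
by rewrite tensmxE !linearZ /= mulrACA.
Qed.

Definition V_of (Delta : 'M[C]_2 -> 'M[C]_(2 * 2)) (phi : {scalar 'M[C]_2}) :
  'M[C]_2 -> C := tens_fun phi phi \o Delta.

Definition quasi_qqo (Delta : {linear 'M[C]_2 -> 'M[C]_(2 * 2)}) : Prop :=
  [/\ Delta 1%:M = 1%:M *t 1%:M,
      forall x, Delta (x^t* ) = (Delta x)^t*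
    & forall phi : {scalar 'M[C]_2},
        positive_functional phi -> positive_functional (V_of Delta phi)].

Definition ntrace (x : 'M[C]_2) : C := 2^-1 * \tr x.

Fact ntrace_is_linear : scalar ntrace.
Proof. by move=> a x y; rewrite /ntrace linearP /= mulrDr mulrCA. Qed.

HB.instance Definition _ :=
  GRing.isLinear.Build C 'M[C]_2 C *%R ntrace ntrace_is_linear.

Definition trace_preserving (Delta : 'M[C]_2 -> 'M[C]_(2 * 2)) : Prop :=
  forall x, tens_fun ntrace ntrace (Delta x) = ntrace x.

End Defs.

(* Main.v *)
(** The matrices 1, sigma_1, sigma_2, sigma_3 are orthonormal for
    (s, x) |-> tau (s x), so every coefficient of Delta (sigma_i) is the value
    on it of a product functional tau (s .) (x) tau (s' .). For s = s' = 1,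
    trace preservation turns this value into tau (sigma_i) = 0. For hermitian
    s and s' the product functional commutes with the adjoint, and
    Delta (sigma_i) is hermitian, so the coefficient is real. The formula for
    Delta (x) is then linearity. *)

Require Import Defs.
From mathcomp Require Import all_boot all_order all_algebra.
From mathcomp Require Import all_reals.

Import Order.TTheory GRing.Theory Num.Theory.
Local Open Scope ring_scope.
Local Open Scope complex_scope.

Lemma tensmx_suml (R : comNzRingType) m n p q k (a : 'I_k -> R)
    (u : 'I_k -> 'M[R]_(m, n)) (y : 'M[R]_(p, q)) :
  (\sum_i a i *: u i) *t y = \sum_i a i *: (u i *t y).
Proof.
apply/matrixP => i j; rewrite !mxE !summxE mulr_suml.
by apply: eq_bigr => l _; rewrite !mxE mulrA.
Qed.

Lemma tensmx_sumr (R : comNzRingType) m n p q k (a : 'I_k -> R)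
    (x : 'M[R]_(m, n)) (u : 'I_k -> 'M[R]_(p, q)) :
  x *t (\sum_i a i *: u i) = \sum_i a i *: (x *t u i).
Proof.
apply/matrixP => i j; rewrite !mxE !summxE mulr_sumr.
by apply: eq_bigr => l _; rewrite !mxE mulrCA.
Qed.

Lemma pauli_adjoint (R : realType) a : ((pauli R a)^t* )%sesqui = pauli R a.
Proof.
by apply/matrixP => i j; rewrite !mxE;
  case: a => -[|[|[|//]]] ?; case: i => -[|[|//]] ?; case: j => -[|[|//]] ?;
  rewrite !mxE /= ?conjC0 ?conjC1 ?rmorphN ?conjC1 // ?opprK //;
  apply/eqP; rewrite eq_complex /= ?oppr0 ?opprK !eqxx.
Qed.

Lemma ntrace_scalar (R : realType) (a : R[i]) : ntrace a%:M = a.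
Proof. by rewrite /ntrace mxtrace_scalar -[a *+ 2]mulr_natl mulKf ?pnatr_eq0. Qed.

Lemma ntrace_pauli (R : realType) a : ntrace (pauli R a) = 0.
Proof.
rewrite /ntrace /mxtrace !big_ord_recl big_ord0 /= addr0.
by case: a => -[|[|[|//]]] ?; rewrite !mxE /= ?addr0 ?subrr mulr0.
Qed.

(** Two distinct Pauli matrices multiply to a scalar multiple of the third, which is traceless, and
    each squares to the identity. The nine cases are computed entrywise. *)
Lemma ntrace_pauliM (R : realType) a c :
  ntrace (pauli R a *m pauli R c) = (a == c)%:R.
Proof.
have ii : 'i%C * 'i%C = -1 :> R[i] by rewrite -expr2 sqr_i.
rewrite /ntrace /mxtrace !big_ord_recl big_ord0 /= addr0 !mxE.
rewrite !big_ord_recl !big_ord0 /= !addr0.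
case: a => -[|[|[|//]]] ?; case: c => -[|[|[|//]]] ?;
  rewrite !mxE /= -?val_eqE /=;
  rewrite ?(mulr0, mul0r, mulr1, mul1r, mulrN, mulNr, addr0, add0r, oppr0,
            opprK, ii, subrr, addNr) //.
all: by rewrite -[1 + 1]/(2%:R) mulVf ?pnatr_eq0.
Qed.

Lemma ntrace_adjoint (R : realType) (x : 'M[R[i]]_2) :
  ntrace (x^t* )%sesqui = Num.conj (ntrace x).
Proof.
rewrite /ntrace rmorphM fmorphV rmorph_nat; congr (_ * _).
by rewrite rmorph_sum; apply: eq_bigr => i _; rewrite !mxE.
Qed.

(** The adjoint of a matrix unit has its two indices swapped, so after exchanging the summations
    over [i], [j] and over [k], [l] the two sides agree term by term. *)
Lemma tens_fun_adjoint (R : realType) m n (phi : {scalar 'M[R[i]]_m})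
    (psi : {scalar 'M[R[i]]_n}) (X : 'M_(m * n)) :
    (forall x, phi (x^t* )%sesqui = Num.conj (phi x)) ->
    (forall y, psi (y^t* )%sesqui = Num.conj (psi y)) ->
  tens_fun phi psi (X^t* )%sesqui = Num.conj (tens_fun phi psi X).
Proof.
have delta_adj p (i j : 'I_p) :
    ((delta_mx i j : 'M[R[i]]_p)^t* )%sesqui = delta_mx j i.
  by apply/matrixP => k l; rewrite !mxE rmorph_nat andbC.
move=> phiP psiP; rewrite /tens_fun exchange_big rmorph_sum.
apply: eq_bigr => i _; rewrite rmorph_sum; apply: eq_bigr => j _.
rewrite exchange_big rmorph_sum.
apply: eq_bigr => k _; rewrite rmorph_sum; apply: eq_bigr => l _.
by rewrite !mxE !rmorphM /= -phiP -psiP !delta_adj.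
Qed.

(** For hermitian [s] this is the normalized Hilbert-Schmidt product with [s]; at a Pauli matrix or
    the identity it is a coordinate functional. *)
Definition trace_pairing {R : realType} (s : 'M[R[i]]_2) : {scalar 'M[R[i]]_2} :=
  @ntrace R \o mulmx s.

(** The adjoint of [s *m x] is [x^t* *m s] when [s] is hermitian, and the trace is cyclic. *)
Lemma trace_pairing_adjoint (R : realType) (s x : 'M[R[i]]_2) :
  (s^t* )%sesqui = s ->
  trace_pairing s (x^t* )%sesqui = Num.conj (trace_pairing s x).
Proof.
move=> s_herm; rewrite /= -ntrace_adjoint trmx_mul map_mxM s_herm.
by rewrite /ntrace mxtrace_mulC.
Qed.

Section PauliExpansion.
Variables (R : realType) (c : R[i]) (u v : 'I_3 -> R[i]).
Variable t : 'I_3 -> 'I_3 -> R[i].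

(** The shape of [Delta (pauli R i)] for a fixed [i], with arbitrary coefficients: [u] belongs to
    the right tensor factor, [v] to the left one. *)
Let X : 'M[R[i]]_(2 * 2) :=
  c *: (1%:M *t 1%:M) + \sum_(j < 3) u j *: (1%:M *t pauli R j)
  + \sum_(j < 3) v j *: (pauli R j *t 1%:M)
  + \sum_(m < 3) \sum_(l < 3) t m l *: (pauli R m *t pauli R l).

Lemma tens_fun_expansion (phi psi : {scalar 'M[R[i]]_2}) :
  tens_fun phi psi X =
    c * (phi 1%:M * psi 1%:M) + \sum_(j < 3) u j * (phi 1%:M * psi (pauli R j))
    + \sum_(j < 3) v j * (phi (pauli R j) * psi 1%:M)
    + \sum_(m < 3) \sum_(l < 3) t m l * (phi (pauli R m) * psi (pauli R l)).
Proof.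
rewrite /X !linearD !linear_sum linearZ /= tens_funE.
congr (_ + _ + _ + _); apply: eq_bigr => i _; rewrite ?linearZ /= ?tens_funE //.
by rewrite linear_sum; apply: eq_bigr => j _; rewrite linearZ /= tens_funE.
Qed.

Let sum_kron (F : 'I_3 -> R[i]) k : \sum_(i < 3) F i * (k == i)%:R = F k.
Proof.
rewrite (bigD1 k) //= eqxx mulr1 big1 ?addr0 // => i /negPf.
by rewrite eq_sym => ->; rewrite mulr0.
Qed.

Let coordE := (mulmx1, mul1mx, ntrace_scalar, ntrace_pauli, ntrace_pauliM).

(** Every term but the first contains the trace of a Pauli matrix. *)
Lemma expansion_coef1 : tens_fun (@ntrace R) (@ntrace R) X = c.
Proof.
rewrite tens_fun_expansion /= !coordE !mulr1.
rewrite !big1 ?addr0 // => i _; last by rewrite !coordE !mulr0.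
  by rewrite big1 // => j _; rewrite !coordE !mulr0.
by rewrite !coordE mul0r mulr0.
Qed.

(** Pairing with the identity on the left kills every term with a Pauli matrix there; pairing with
    [pauli R j] on the right then selects one index. Writing [trace_pairing 1%:M] for the trace
    gives all three kinds of coefficient the form used in [coef_real]. *)
Lemma expansion_coefr j :
  tens_fun (trace_pairing 1%:M) (trace_pairing (pauli R j)) X = u j.
Proof.
rewrite tens_fun_expansion /= !coordE !mulr0 add0r -[RHS]sum_kron.
rewrite [X in _ + X + _]big1 => [|i _]; last by rewrite !coordE !mulr0.
rewrite [X in _ + X]big1 ?addr0 => [|i _].
  by apply: eq_bigr => i _; rewrite !coordE mul1r.
by rewrite big1 // => k _; rewrite !coordE mul0r mulr0.
Qed.

Lemma expansion_coefl j :
  tens_fun (trace_pairing (pauli R j)) (trace_pairing 1%:M) X = v j.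
Proof.
rewrite tens_fun_expansion /= !coordE mul0r mulr0 add0r -[RHS]sum_kron.
rewrite [X in X + _ + _]big1 ?add0r => [|i _]; last by rewrite mul0r mulr0.
rewrite [X in _ + X]big1 ?addr0 => [|i _].
  by apply: eq_bigr => i _; rewrite !coordE mulr1.
by rewrite big1 // => k _; rewrite !coordE !mulr0.
Qed.

Lemma expansion_coef m l :
  tens_fun (trace_pairing (pauli R m)) (trace_pairing (pauli R l)) X = t m l.
Proof.
rewrite tens_fun_expansion /= !coordE mul0r mulr0 add0r.
rewrite [X in X + _ + _]big1 ?add0r => [|i _]; last by rewrite mul0r mulr0.
rewrite [X in X + _]big1 ?add0r => [|i _]; last by rewrite !mulr0.
rewrite -[RHS](sum_kron (t^~ l)); apply: eq_bigr => i _.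
rewrite -[in RHS](sum_kron (t i)) mulr_suml; apply: eq_bigr => k _.
by rewrite !coordE mulrCA mulrC.
Qed.

End PauliExpansion.

Theorem proposition3p2 (R : realType)
    (Delta : {linear 'M[R[i]]_2 -> 'M[R[i]]_(2 * 2)})
    (Delta_qqo : quasi_qqo Delta) (Delta_tr : trace_preserving Delta)
    (b : 'I_3 -> R[i]) (B1 B2 : 'M[R[i]]_3) (bb : 'I_3 -> 'I_3 -> 'cV[R[i]]_3)
    (Delta_pauli : forall i : 'I_3,
       Delta (pauli R i) =
         b i *: (1%:M *t 1%:M)
         + \sum_(j < 3) B1 j i *: (1%:M *t pauli R j)
         + \sum_(j < 3) B2 j i *: (pauli R j *t 1%:M)
         + \sum_(m < 3) \sum_(l < 3) bb m l i 0 *: (pauli R m *t pauli R l)) :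
  [/\ forall j : 'I_3, b j = 0,
      forall i j : 'I_3, B1 i j \is Num.real,
      forall i j : 'I_3, B2 i j \is Num.real,
      forall i j k : 'I_3, bb i j k 0 \is Num.real
    & forall (w0 : R[i]) (w : 'cV[R[i]]_3),
        Delta (w0 *: 1%:M + dot_pauli w) =
          w0 *: (1%:M *t 1%:M)
          + 1%:M *t dot_pauli (B1 *m w)
          + dot_pauli (B2 *m w) *t 1%:M
          + \sum_(m < 3) \sum_(l < 3)
              innerC3 (bb m l) (map_mx Num.conj w) *: (pauli R m *t pauli R l)].
Proof.
case: Delta_qqo => Delta1 Delta_adj _.
have b0 j : b j = 0.
  by rewrite -(ntrace_pauli R j) -Delta_tr Delta_pauli expansion_coef1.
have adj1 : ((1%:M : 'M[R[i]]_2)^t* )%sesqui = 1%:M.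
  by rewrite trmx1 map_mx1.
have coef_real (s s' : 'M[R[i]]_2) i :
    (s^t* )%sesqui = s -> (s'^t* )%sesqui = s' ->
    tens_fun (trace_pairing s) (trace_pairing s') (Delta (pauli R i))
      \is Num.real.
  (* Reality is invariance under conjugation, which moves inside as the adjoint and is absorbed by
     [Delta] and then by the Pauli matrix. *)
  move=> s_herm s'_herm; apply/CrealP.
  rewrite -tens_fun_adjoint => [|x|y]; try exact: trace_pairing_adjoint.
  by rewrite -Delta_adj pauli_adjoint.
split=> // [i j|i j|i j k|w0 w].
(* The second index of [B1] numbers the argument of [Delta], so column [j] supplies the coefficients
   of [Delta (pauli R j)]. *)
- rewrite -[B1 i j](expansion_coefr R (b j) (B1^~ j) (B2^~ j)
    (fun m l => bb m l j 0) i) -Delta_pauli.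
  by apply: coef_real => //; apply: pauli_adjoint.
- rewrite -[B2 i j](expansion_coefl R (b j) (B1^~ j) (B2^~ j)
    (fun m l => bb m l j 0) i) -Delta_pauli.
  by apply: coef_real => //; apply: pauli_adjoint.
- rewrite -[bb i j k 0](expansion_coef R (b k) (B1^~ k) (B2^~ k)
    (fun m l => bb m l k 0) i j) -Delta_pauli.
  by apply: coef_real; apply: pauli_adjoint.
rewrite linearD linearZ /= Delta1 -!addrA; congr (_ + _); rewrite !addrA.
rewrite /dot_pauli tensmx_sumr tensmx_suml linear_sum /=.
under eq_bigr => i _.
  rewrite linearZ /= Delta_pauli b0 scale0r add0r !scalerDr !scaler_sumr.
  over.
(* Moving the sum over the coordinates of [w] innermost collects the coefficient of each basis
   tensor: an entry of [B1 *m w] or [B2 *m w], or an inner product. *)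
rewrite !big_split /= exchange_big [X in _ + X + _]exchange_big.
rewrite [X in _ + X = _]exchange_big; congr (_ + _ + _); apply: eq_bigr => j _.
- by rewrite mxE scaler_suml; apply: eq_bigr => i _; rewrite scalerA mulrC.
- by rewrite mxE scaler_suml; apply: eq_bigr => i _; rewrite scalerA mulrC.
under eq_bigr do rewrite scaler_sumr.
rewrite exchange_big; apply: eq_bigr => l _; rewrite scaler_suml.
(* The conjugation in [innerC3] cancels the one applied to [w]. *)
by apply: eq_bigr => i _; rewrite scalerA mxE conjCK mulrC.
Qed.
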